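(* Let $q$ be an odd prime power, $\mathbb F_q$ the finite field of order $q$, $d$ a positive integer, and $A\subset \mathbb F_q^d$. Let $\mathcal{SQ}(A)$ be the number of pairs $(x,y)\in A\times A$ such that $\eta(\|x-y\|)=1$. \begin{enumerate} \item Let $d\equiv 3 \pmod 4$ and $q\equiv 3\pmod 4$. If $|A|\ge (q^{(d+1)/2}+q)/(1+q^{-(d-1)/2})$, then $$\mathcal{SQ}(A)\le \frac{|A|^2}{2} + q^{\frac{d-1}{2}} |A| -\frac{|A|^2}{2q}- \frac{|A|^2}{2 q^{\frac{d-1}{2}}} - \frac{|A|^2}{2 q^{\frac{d+1}{2}}}.$$ If $|A|\le (q^{(d+1)/2}+q)/(1+q^{-(d-1)/2})$, then $$\mathcal{SQ}(A) \le \frac{|A|^2}{2} + \frac{q^{\frac{d-1}{2}} |A|}{2} - \frac{|A|^2}{2 q^{\frac{d-1}{2}}} -\frac{|A|}{2}.$$ \item Let $d\equiv 1 \pmod 4$, or $d\equiv 3\pmod 4$ and $q\equiv 1\pmod 4$. Then $$\mathcal{SQ}(A) \le \frac{|A|^2}{2} - \frac{q^{\frac{d-1}{2}} |A|}{2} -\frac{|A|}{2}+ \min\left\{ \frac{q^{\frac{d+1}{2}} |A|}{2},~ \frac{q^{\frac{d-1}{2}} |A|}{2}+ \frac{|A|^2}{2},~\frac{|A|}{2}+ \frac{q^{\frac{d+1}{2}} |A|}{2}-\frac{|A|^2}{2q} \right\}.$$ \end{enumerate}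
   Context: For $x,y\in\mathbb F_q^d$, $\|x-y\|:=(x_1-y_1)^2+\cdots+(x_d-y_d)^2\in\mathbb F_q$. $\eta$ denotes the quadratic character of $\mathbb F_q$ (so $\eta(a)=1$ if $a$ is a nonzero square, $\eta(a)=-1$ if $a$ is a non-square) with the convention $\eta(0)=0$. *)

(* Defs.v *)
From HB Require Import structures.
From mathcomp Require Import all_boot all_order all_algebra all_field.
Set Implicit Arguments. Unset Strict Implicit. Unset Printing Implicit Defensive.
Import Order.TTheory GRing.Theory Num.Theory.
Local Open Scope ring_scope.

Definition sqdist (F : finFieldType) (d : nat) (x y : 'rV[F]_d) : F :=
  \sum_(i < d) (x ord0 i - y ord0 i) ^+ 2.

Definition eta (F : finFieldType) (a : F) : int :=
  if a == 0 then 0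
  else if [exists b : F, b ^+ 2 == a] then 1 else -1.

Definition SQ (F : finFieldType) (d : nat) (A : {set 'rV[F]_d}) : nat :=
  #|[set p in setX A A | eta (sqdist p.1 p.2) == 1]|.

(* Main.v *)
From mathcomp Require Import all_boot all_order all_algebra all_fingroup.
From mathcomp Require Import all_solvable all_field all_character.
From mathcomp Require Import zify ring lra.
Require Import Defs.
Set Implicit Arguments. Unset Strict Implicit. Unset Printing Implicit Defensive.
Import Order.TTheory GRing.Theory Num.Theory.
Local Open Scope ring_scope.

(* For d = 2m + 1 put e = eta(-1)^m.  Evaluating Gauss sums, the Fourier
   transform of the indicator of the isotropic cone ||x|| = 0 is
   z |-> q^(2m) [z = 0] + e q^m eta(||z||), and that of x |-> eta(||x||) is
   z |-> e q^m (q [||z|| = 0] - 1).  If w >= 0 has transform g, then the sum of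
   g(x - y) over x, y in A is nonnegative.  Taking for w the indicators of the
   nonzero isotropic vectors, and (twice) those of the vectors with eta(||x||) = 1
   and = -1, gives three linear inequalities between |A|, the sum D of
   eta(||x - y||) and the number N of pairs with ||x - y|| = 0.  As
   2 SQ(A) = |A|^2 - N + D and N >= |A|, all the bounds are linear combinations
   of these inequalities. *)

(** * The quadratic character of a finite field of odd order *)

Section QuadraticCharacter.
Variable F : finFieldType.
Implicit Types a b v : F.

(** Lagrange's theorem in the additive group of [F], applied to the element 1. *)
Lemma natr_card_eq0 : #|F|%:R = 0 :> F.
Proof.
have := expg_cardG (in_setT (1 : F)).
by rewrite cardsT FinRing.zmodXgE FinRing.zmod1gE.
Qed.

Lemma eta0 : eta (0 : F) = 0.
Proof. by rewrite /eta eqxx. Qed.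

Lemma eta_sqr b : b != 0 -> eta (b ^+ 2) = 1.
Proof.
move=> b0; rewrite /eta expf_eq0 /= (negPf b0).
by case: existsP => // -[]; exists b.
Qed.

Variant eta_spec a : int -> Prop :=
| EtaZero of a = 0 : eta_spec a 0
| EtaSquare b of b != 0 & a = b ^+ 2 : eta_spec a 1
| EtaNonsquare of a != 0 & (forall b, a <> b ^+ 2) : eta_spec a (-1).

Lemma etaP a : eta_spec a (eta a).
Proof.
rewrite /eta; have [->|a0] := eqVneq; first exact: EtaZero.
case: existsP => [[b /eqP ab]|nab]; [apply: (EtaSquare (b := b)) => //|].
  by apply: contraNneq a0 => b0; rewrite -ab b0 expr0n.
by apply: EtaNonsquare => // b ab; apply: nab; exists b; rewrite ab.
Qed.

Hypothesis oddF : odd #|F|.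

(** If 2 vanished in [F], the odd number [#|F|], which is zero there, would equal 1. *)
Lemma natr2_neq0 : 2%:R != 0 :> F.
Proof.
apply/eqP=> F2; have := natr_card_eq0; rewrite -[#|F|]odd_double_half oddF.
by rewrite -muln2 natrD natrM F2 mulr0 addr0 => /eqP; rewrite oner_eq0.
Qed.

Lemma card_sqrt v : #|[pred t : F | t ^+ 2 == v]|%:Z = 1 + eta v.
Proof.
case: etaP => [->|b b0 ->|v0 nsq].
- by rewrite (eq_card (B := pred1 0)) ?card1 // => t; rewrite !inE expf_eq0.
- rewrite (eq_card (B := pred2 b (- b))) => [|t].
    rewrite card2 -subr_eq0 opprK -mulr2n.
    by rewrite -mulr_natl mulf_eq0 (negPf natr2_neq0) (negPf b0).
  by rewrite !inE eqf_sqr.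
by apply/eqP; rewrite addrN /= -[0]/(0%:Z) eqz_nat; apply/eqP/eq_card0 => t;
  rewrite !inE; apply/eqP=> tv; apply: (nsq t).
Qed.

(** Group the [t] by the value of their square and count each fibre with [card_sqrt]. *)
Lemma sum_sqr (V : zmodType) (g : F -> V) :
  \sum_t g (t ^+ 2) = \sum_v g v *~ (1 + eta v).
Proof.
rewrite (partition_big (fun t => t ^+ 2) predT) //=; apply: eq_bigr => v _.
rewrite (eq_bigr (fun=> g v)) => [|t /eqP->//].
by rewrite sumr_const -card_sqrt.
Qed.

(** With [g] constantly 1 in [sum_sqr], both sides contain a sum of 1 over [F], which cancels. *)
Lemma sum_eta : \sum_(v : F) eta v = 0.
Proof.
have := sum_sqr (fun=> 1 : int); under [in RHS]eq_bigr do rewrite intz.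
by rewrite big_split /= -[LHS]addr0 => /addrI.
Qed.

Lemma etaMsqr b a : b != 0 -> eta (b ^+ 2 * a) = eta a.
Proof.
move=> b0; case: (etaP a) => [->|c c0 ->|a0 nsq].
- by rewrite mulr0 eta0.
- by rewrite -exprMn eta_sqr // mulf_neq0.
case: etaP => // [/eqP|c c0 E].
  by rewrite mulf_eq0 expf_eq0 (negPf b0) (negPf a0).
by case: (nsq (c / b)); rewrite exprMn -E exprVn mulrAC mulfV ?mul1r ?expf_neq0.
Qed.

(* For a nonsquare [a] the terms of [\sum_v (eta (a * v) + eta v) = 0] are
   nonpositive, hence they all vanish. *)
Lemma etaM a b : eta (a * b) = eta a * eta b.
Proof.
case: (etaP a) => [->|c c0 ->|a0 nsq]; first by rewrite mul0r eta0 mul0r.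
  by rewrite etaMsqr // mul1r.
have sum0 : \sum_v - (eta (a * v) + eta v) = 0.
  rewrite sumrN big_split /= sum_eta addr0.
  have := sum_eta; rewrite (reindex_inj (mulfI a0)) /= => ->.
  by rewrite oppr0.
have ge0 v : true -> 0 <= - (eta (a * v) + eta v).
  move=> _; case: (etaP v) => [->|c c0 ->|v0 _]; first by rewrite mulr0 eta0.
    rewrite mulrC etaMsqr //.
    by case: (etaP a) => // [/eqP|c' _ /nsq //]; rewrite (negPf a0).
  by case: (etaP (a * v)).
have /eqP := psumr_eq0P ge0 sum0 (i := b) isT.
by rewrite oppr_eq0 addr_eq0 mulN1r => /eqP.
Qed.

Lemma etaV a : eta a^-1 = eta a.
Proof.
have [->|a0] := eqVneq a 0; first by rewrite invr0.
by rewrite -[a^-1](mulKf a0) mulrCA -expr2 mulrC etaMsqr ?invr_eq0.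
Qed.

Lemma sqr_eta a : a != 0 -> eta a ^+ 2 = 1.
Proof. by case: etaP => // ->; rewrite eqxx. Qed.

Lemma sqr_eta_opp1 : eta (- 1 : F) ^+ 2 = 1.
Proof. by rewrite sqr_eta // oppr_eq0 oner_eq0. Qed.

(** Write [#|F| = 4k + 1]. The polynomial [X^(2k) - 1] has at most [2k] roots, so one of the [4k]
    nonzero elements, [c], has [c^(2k) != 1]. As [c^(4k) = 1], this forces [c^(2k) = -1], and -1 is
    the square of [c^k]. *)
Lemma eta_opp1_mod41 : (#|F| %% 4 = 1)%N -> eta (- 1 : F) = 1.
Proof.
move=> F1; have DF := divn_eq #|F| 4; rewrite F1 in DF.
set k := (_ %/ 4)%N in DF.
have k0 : (0 < k)%N.
  by rewrite lt0n; apply: contraTneq (card_finNzRing_gt1 F) => k0; rewrite DF k0.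
have [c c0 ck] : exists2 c : F, c != 0 & c ^+ (k * 2) != 1.
  apply/exists_inP; rewrite -[X in is_true X]negbK negb_exists_in.
  apply/negP => /forall_inP allc.
  pose p : {poly F} := 'X^(k * 2) - 1.
  have sp : size p = (k * 2).+1 by rewrite size_XnsubC ?muln_gt0 ?k0.
  have p0 : p != 0 by rewrite -size_poly_eq0 sp.
  have rts : all (root p) (enum [pred x : F | x != 0]).
    apply/allP=> x; rewrite mem_enum inE => /allc; rewrite negbK => /eqP xk.
    by rewrite /root !hornerE xk subrr.
  have := max_poly_roots p0 rts (enum_uniq _).
  by rewrite sp -cardE cardC1 DF addn1 /= ltnS leqNgt ltn_pmul2l.
have ck2 : (c ^+ k) ^+ 2 = -1.
  have : (c ^+ (k * 2)) ^+ 2 == 1 ^+ 2.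
    rewrite -exprM -mulnA expr1n -(inj_eq (mulfI c0)) -exprS mulr1.
    by rewrite -addn1 -DF expf_card.
  by rewrite eqf_sqr (negPf ck) exprM => /eqP.
by rewrite -ck2 eta_sqr // expf_neq0.
Qed.

(** If [-1 = b^2], then [b^4 = 1], so [b = b^#|F| = b^3 = -b], which is impossible in odd
    characteristic. *)
Lemma eta_opp1_mod43 : (#|F| %% 4 = 3)%N -> eta (- 1 : F) = - 1.
Proof.
move=> F3; case: etaP => // [/eqP|b b0 b2]; first by rewrite oppr_eq0 oner_eq0.
have b4 : b ^+ 4 = 1 by rewrite (exprM b 2 2) -b2 sqrrN expr1n.
have := expf_card b; rewrite (divn_eq #|F| 4) F3 mulnC exprD exprM b4 expr1n.
rewrite mul1r exprS -b2 mulrN1 => /eqP; rewrite eq_sym -addr_eq0 -mulr2n.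
by rewrite -mulr_natl mulf_eq0 (negPf natr2_neq0) (negPf b0).
Qed.

End QuadraticCharacter.

(** * Nontrivial additive characters *)

Record additive_character (F : finFieldType) (chi : F -> algC) : Prop := {
  addcharD : {morph chi : x y / x + y >-> x * y};
  addchar0 : chi 0 = 1;
  addcharN : forall x, chi (- x) = (chi x)^*;
  addchar_neq1 : exists x, chi x != 1 }.

(** An abelian group has as many irreducible characters as elements, all of them linear; index 0 is
    the principal one, so index 1 gives a nontrivial one. *)
Lemma additive_character_exists (F : finFieldType) :
  exists chi : F -> algC, additive_character chi.
Proof.
pose G := [group of [set: F]].
have cGG : abelian G := FinRing.zmod_abelian _.
have G1 : (1 < Nirr G)%N.
  rewrite NirrE; move: cGG; rewrite card_classes_abelian => /eqP->.
  by rewrite cardsT card_finNzRing_gt1.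
pose i : Iirr G := Ordinal G1.
have lin_i : 'chi_i \is a linear_char by apply/char_abelianP.
exists 'chi_i; split=> [x y||x|].
- by rewrite -FinRing.zmodMgE lin_charM ?inE.
- by rewrite -FinRing.zmod1gE lin_char1.
- by rewrite -FinRing.zmodVgE lin_charV_conj ?inE.
apply/existsP; have: 'chi_i != 1 by rewrite irr_eq1.
apply: contraR => /existsPn i1; apply/eqP/cfun_inP=> x Gx.
by rewrite cfun1E Gx; apply/eqP; rewrite -[_ == _]negbK i1.
Qed.

(** * Orthogonality and quadratic Gauss sums *)

Section GaussSums.
Variables (F : finFieldType) (chi : F -> algC).
Hypothesis chiP : additive_character chi.
Implicit Types a s t u v : F.

Lemma sum_addchar a : \sum_t chi (a * t) = #|F|%:R * (a == 0)%:R.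
Proof.
have [->|a0] := eqVneq.
  under eq_bigr do rewrite mul0r (addchar0 chiP).
  by rewrite sumr_const mulr1.
(* Shifting [t] by [u / a] multiplies the sum by [chi u], which differs from 1, so the sum
   vanishes. *)
have [u u1] := addchar_neq1 chiP; rewrite mulr0.
apply: (mulfI (x := chi u - 1)); first by rewrite subr_eq0.
rewrite mulr0 mulrBl mul1r; apply/eqP; rewrite subr_eq0; apply/eqP.
rewrite [RHS](reindex_inj (addrI (u / a))) mulr_sumr; apply: eq_bigr => t _.
by rewrite mulrDr (addcharD chiP) mulrCA mulfV ?mulr1.
Qed.

Hypothesis oddF : odd #|F|.

Definition gauss_sum : algC := \sum_t chi (t ^+ 2).

(** In the weight [1 + eta v] of [sum_sqr], the part 1 contributes nothing by orthogonality. *)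
Lemma sum_addchar_sqr a : a != 0 ->
  \sum_t chi (a * t ^+ 2) = \sum_v (eta v)%:~R * chi (a * v).
Proof.
move=> a0; rewrite (sum_sqr oddF (fun v => chi (a * v))).
under eq_bigr do rewrite mulrzDr mulr1z -mulrzl.
by rewrite big_split /= sum_addchar (negPf a0) mulr0 add0r.
Qed.

Lemma sum_eta_addchar a :
  \sum_v (eta v)%:~R * chi (a * v) = (eta a)%:~R * gauss_sum.
Proof.
have [->|a0] := eqVneq a 0.
  under eq_bigr do rewrite mul0r (addchar0 chiP) mulr1.
  by rewrite -rmorph_sum /= sum_eta // eta0 mul0r.
rewrite /gauss_sum; under [in RHS]eq_bigr do rewrite -[_ ^+ 2]mul1r.
rewrite sum_addchar_sqr ?oner_eq0 // (reindex_inj (mulfI (invr_neq0 a0))) /=.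
rewrite mulr_sumr; apply: eq_bigr => v _.
by rewrite mulVKf // etaM // etaV // intrM mul1r mulrA.
Qed.

(** Conjugation multiplies the sum by [eta (- 1)], so the square follows from the squared modulus
    [#|F|]. *)
Lemma gauss_sum_sqr : gauss_sum ^+ 2 = (eta (- 1 : F))%:~R * #|F|%:R.
Proof.
have conjG : gauss_sum^* = (eta (- 1 : F))%:~R * gauss_sum.
  rewrite -sum_eta_addchar -sum_addchar_sqr ?oppr_eq0 ?oner_eq0 //.
  rewrite rmorph_sum; apply: eq_bigr => t _.
  by rewrite mulN1r (addcharN chiP).
suff normG : gauss_sum * gauss_sum^* = #|F|%:R.
  rewrite -normG conjG [gauss_sum * _]mulrCA [RHS]mulrA -intrM -expr2.
  by rewrite sqr_eta_opp1 mul1r.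
(* [t ^ 2 - u ^ 2 = (t - u) * (t + u)], and [u] is replaced by [t - w] *)
rewrite rmorph_sum mulr_suml /=.
transitivity (\sum_t \sum_w chi (- w ^+ 2) * chi (w * (2 * t))).
  apply: eq_bigr => t _; rewrite mulr_sumr (reindex_inj (subrI t)).
  apply: eq_bigr => w _; rewrite -(addcharN chiP) -!(addcharD chiP).
  by congr chi; ring.
(* For fixed [w] the sum over [t] is a character sum with frequency [2 * w]; only [w = 0]
   survives. *)
rewrite exchange_big (bigD1 0) //= [X in _ + X]big1 ?addr0 => [|w w0].
  rewrite expr0n oppr0 (addchar0 chiP) -mulr_sumr mul1r.
  under eq_bigr do rewrite mul0r (addchar0 chiP).
  by rewrite sumr_const.
rewrite -mulr_sumr; under eq_bigr do rewrite mulrA.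
by rewrite sum_addchar !mulf_eq0 (negPf w0) (negPf (natr2_neq0 oddF)) !mulr0.
Qed.

Lemma gauss_sum_neq0 : gauss_sum != 0.
Proof.
rewrite -sqrf_eq0 gauss_sum_sqr mulf_neq0 ?pnatr_eq0 -?lt0n //.
  by rewrite intr_eq0 -sqrf_eq0 sqr_eta_opp1.
by rewrite -cardsT cardsT (ltn_trans _ (card_finNzRing_gt1 F)).
Qed.

Lemma sum_addchar_quadratic s u : s != 0 ->
  \sum_t chi (s * t ^+ 2 + t * u) =
  (eta s)%:~R * gauss_sum * chi (- (4 * s)^-1 * u ^+ 2).
Proof.
move=> s0; rewrite -sum_eta_addchar -sum_addchar_sqr // mulr_suml.
have n2 := natr2_neq0 oddF.
have n4 : 4 != 0 :> F by rewrite (natrM _ 2 2) mulf_neq0.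
(* Completing the square: this shift removes the linear term. *)
rewrite (reindex_inj (subIr (u / (2 * s)))) /=; apply: eq_bigr => t _.
by rewrite -(addcharD chiP); congr chi; field; rewrite s0 n4 n2.
Qed.

(** * Character sums over the vector space *)

Section Fourier.
Variable d : nat.
Implicit Types x y z : 'rV[F]_d.

Definition dot x y : F := \sum_(i < d) x ord0 i * y ord0 i.

Lemma addchar_sum (I : finType) (f : I -> F) :
  chi (\sum_i f i) = \prod_i chi (f i).
Proof. exact: (big_morph chi (addcharD chiP) (addchar0 chiP)). Qed.

(** Distributivity, with row vectors read as finite functions; it reduces sums over vectors to sums
    over [F]. *)
Lemma sum_prod_row (f : 'I_d -> F -> algC) :
  \sum_(x : 'rV[F]_d) \prod_i f i (x ord0 i) = \prod_i \sum_t f i t.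
Proof.
rewrite bigA_distr_bigA /=.
rewrite (reindex (fun g : {ffun 'I_d -> F} => \row_i g i)) /=.
  by apply: eq_bigr => g _; apply: eq_bigr => i _; rewrite mxE.
exists (fun x : 'rV[F]_d => [ffun i => x ord0 i]) => [g _|x _].
  by apply/ffunP=> i; rewrite ffunE mxE.
by apply/rowP=> i; rewrite mxE ffunE.
Qed.

Lemma dotBl x y z : dot (x - y) z = dot x z - dot y z.
Proof.
by rewrite /dot -sumrB; apply: eq_bigr => i _; rewrite !mxE mulrBl.
Qed.

Lemma dotC x y : dot x y = dot y x.
Proof. by rewrite /dot; apply: eq_bigr => i _; rewrite mulrC. Qed.

Lemma dot0r x : dot x 0 = 0.
Proof. by rewrite /dot big1 // => i _; rewrite mxE mulr0. Qed.

Lemma sum_addchar_dot z :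
  \sum_x chi (dot x z) = #|F|%:R ^+ d * (z == 0)%:R.
Proof.
have [->|z0] := eqVneq.
  under eq_bigr do rewrite dot0r (addchar0 chiP).
  by rewrite sumr_const card_mx mul1n natrX mulr1.
under eq_bigr do rewrite addchar_sum.
rewrite (sum_prod_row (fun i t => chi (t * z ord0 i))) mulr0.
have [i zi] : exists i, z ord0 i != 0.
  apply/existsP; apply: contraR z0 => /existsPn z0; apply/eqP/rowP=> i.
  by rewrite mxE; apply/eqP; rewrite -[_ == _]negbK z0.
rewrite (bigD1 i) //=; under eq_bigr do rewrite mulrC.
by rewrite sum_addchar (negPf zi) mulr0 mul0r.
Qed.

Lemma sum_addchar_dot_quadratic s z : s != 0 ->
  \sum_x chi (s * dot x x + dot x z) =
  ((eta s)%:~R * gauss_sum) ^+ d * chi (- (4 * s)^-1 * dot z z).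
Proof.
move=> s0; pose f i t := chi (s * t ^+ 2 + t * z ord0 i).
transitivity (\sum_(x : 'rV[F]_d) \prod_i f i (x ord0 i)).
  apply: eq_bigr => x _; rewrite /dot mulr_sumr -big_split addchar_sum.
  by apply: eq_bigr => i _; rewrite /f expr2.
rewrite sum_prod_row {}/f; under eq_bigr do rewrite sum_addchar_quadratic //.
rewrite big_split /= prodr_const card_ord -addchar_sum -mulr_sumr.
by under eq_bigr do rewrite expr2.
Qed.

End Fourier.
End GaussSums.

(** * Fourier transforms of the cone and of the quadratic character in odd dimension *)

Section OddDimension.
Variables (F : finFieldType) (chi : F -> algC).
Hypothesis chiP : additive_character chi.
Hypothesis oddF : odd #|F|.
Variables d m : nat.
Hypothesis dE : d = m.*2.+1.
Implicit Types x y z : 'rV[F]_d.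
Implicit Type s : F.

Local Notation q := (#|F|%:R : int).
Local Notation e := (eta (- 1 : F)).
Local Notation G := (gauss_sum chi).

Lemma gauss_sum_exp_double k : G ^+ k.*2 = (e ^+ k * q ^+ k)%:~R.
Proof.
by rewrite -mul2n exprM gauss_sum_sqr // -exprMn rmorphXn /= rmorphM rmorph_nat.
Qed.

(** Parity of the dimension enters here: the [d] coordinates contribute [eta s] to the power [d],
    and an odd power fixes 0, 1 and -1. *)
Lemma eta_exp_odd s : (eta s)%:~R ^+ d = (eta s)%:~R :> algC.
Proof.
rewrite dE -rmorphXn /=; congr _%:~R; rewrite exprS -mul2n exprM.
by case: etaP => *; rewrite ?mul0r // ?sqrrN !expr1n mulr1.
Qed.

Lemma eta_neg_quarter s : eta (- (4^-1 * s)) = e * eta s.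
Proof.
have n2 : 2^-1 != 0 :> F by rewrite invr_eq0 natr2_neq0.
by rewrite -[X in eta X = _]mulN1r etaM // (natrM _ 2 2) invfM -expr2 etaMsqr.
Qed.

Lemma neg_quarter_inv s t : - (4 * s)^-1 * t = - (4^-1 * t) * s^-1.
Proof. by rewrite invfM !mulNr mulrAC. Qed.

Lemma fourier_isotropic z :
  \sum_x (dot x x == 0)%:R * chi (dot x z) =
  (q ^+ m.*2 * (z == 0)%:R + e ^+ m * q ^+ m * eta (dot z z))%:~R.
Proof.
have q0 : #|F|%:R != 0 :> algC.
  by rewrite pnatr_eq0 -lt0n (ltn_trans _ (card_finNzRing_gt1 F)).
apply: (mulfI q0); rewrite mulr_sumr.
(* By orthogonality in [s], the condition [dot x x = 0] becomes a sum of characters; [s = 0] yields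
   the point mass at [z = 0]. *)
transitivity (\sum_s \sum_x chi (s * dot x x + dot x z)).
  rewrite exchange_big; apply: eq_bigr => x _.
  rewrite mulrA -(sum_addchar chiP) mulr_suml; apply: eq_bigr => s _.
  by rewrite (addcharD chiP) mulrC [s * _]mulrC mulrC.
rewrite (bigD1 0) //=; under eq_bigr do rewrite mul0r add0r.
rewrite (sum_addchar_dot chiP).
transitivity (#|F|%:R ^+ d * (z == 0)%:R +
  G ^+ d * \sum_s (eta s)%:~R * chi (- (4^-1 * dot z z) * s)).
  (* Inversion is a bijection of [F] with [0^-1 = 0], and the term at 0 vanishes since
     [eta 0 = 0]. *)
  congr (_ + _); rewrite mulr_sumr [RHS](reindex_inj invr_inj) [RHS](bigD1 0) //=.
  rewrite invr0 eta0 mul0r mulr0 add0r; apply: eq_bigr => s s0.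
  rewrite (sum_addchar_dot_quadratic chiP) // exprMn eta_exp_odd etaV //.
  by rewrite neg_quarter_inv mulrCA mulrA.
rewrite sum_eta_addchar // eta_neg_quarter mulrCA -exprSr.
(* There are [d] Gauss sums from the coordinates and one from the sum over [s]: an even number, so
   only the square of [G] matters. *)
have -> : G ^+ d.+1 = (e ^+ m.+1 * q ^+ m.+1)%:~R.
  by rewrite dE -doubleS gauss_sum_exp_double.
have -> : #|F|%:R ^+ d = (q * q ^+ m.*2)%:~R :> algC.
  by rewrite dE -exprS rmorphXn /= rmorph_nat.
have qE k : k%:R = (k%:R : int)%:~R :> algC by rewrite rmorph_nat.
rewrite !(qE #|F|) (qE (z == 0)) -!intrM -intrD; congr (_%:~R).
rewrite !exprS mulrDr !mulrA; congr (_ + _).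
transitivity (e ^+ 2 * (q * e ^+ m * q ^+ m * eta (dot z z))); first by ring.
by rewrite sqr_eta_opp1 mul1r.
Qed.

Lemma fourier_eta z :
  \sum_x (eta (dot x x))%:~R * chi (dot x z) =
  (e ^+ m * q ^+ m * (q * (dot z z == 0)%:R - 1))%:~R.
Proof.
have G0 := gauss_sum_neq0 chiP oddF.
apply: (mulfI G0); rewrite mulr_sumr.
(* The extra factor [G] allows [G * eta (dot x x)] to be expanded by [sum_eta_addchar]. *)
transitivity (\sum_s (eta s)%:~R * \sum_x chi (s * dot x x + dot x z)).
  under [RHS]eq_bigr do rewrite mulr_sumr.
  rewrite exchange_big; apply: eq_bigr => x _.
  rewrite mulrA [G * _]mulrC -sum_eta_addchar // mulr_suml.
  by apply: eq_bigr => s _; rewrite (addcharD chiP) mulrA [s * _]mulrC.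
rewrite (bigD1 0) //= eta0 mul0r add0r.
(* The [eta s] of the expansion cancels the one from the coordinates, leaving a plain additive sum
   without its term at 0. *)
transitivity (G ^+ d * \sum_(s | s != 0) chi (- (4^-1 * dot z z) * s^-1)).
  rewrite mulr_sumr; apply: eq_bigr => s s0.
  rewrite (sum_addchar_dot_quadratic chiP) // exprMn eta_exp_odd -neg_quarter_inv.
  by rewrite !mulrA -intrM -expr2 sqr_eta // mul1r.
have -> : \sum_(s | s != 0) chi (- (4^-1 * dot z z) * s^-1) =
    #|F|%:R * (dot z z == 0)%:R - 1.
  have := sum_addchar chiP (- (4^-1 * dot z z)).
  rewrite (reindex_inj invr_inj) (bigD1 0) //= invr0 mulr0 (addchar0 chiP).
  rewrite oppr_eq0 mulf_eq0 invr_eq0 (natrM _ 2 2) mulf_eq0.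
  by rewrite (negPf (natr2_neq0 oddF)) /= => <-; rewrite [RHS]addrC addKr.
have -> : G ^+ d = G * (e ^+ m * q ^+ m)%:~R.
  by rewrite dE exprS gauss_sum_exp_double.
by rewrite -mulrA [in RHS]intrM rmorphB /= [((_ %:R * _)%:~R)]intrM !rmorph_nat.
Qed.

(** With [c z] the Fourier coefficient of the indicator of [A], the double sum equals the sum of
    [w z] times the squared modulus of [c z]. *)
Lemma pos_def_sum (w g : 'rV[F]_d -> int) (A : {set 'rV[F]_d}) :
  (forall x, 0 <= w x) ->
  (forall z, \sum_x (w x)%:~R * chi (dot x z) = (g z)%:~R) ->
  0 <= \sum_(x in A) \sum_(y in A) g (x - y).
Proof.
move=> w0 gE; rewrite -(ler0z algC) rmorph_sum /=.
pose c x := \sum_(y in A) chi (dot y x).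
suff -> : \sum_(x in A) (\sum_(y in A) g (x - y))%:~R =
    \sum_z (w z)%:~R * (c z * (c z)^*).
  by apply: sumr_ge0 => z _; rewrite mulr_ge0 ?mul_conjC_ge0 // ler0z.
transitivity (\sum_z \sum_(x in A) \sum_(y in A)
    (w z)%:~R * (chi (dot x z) * (chi (dot y z))^*)).
  rewrite exchange_big; apply: eq_bigr => x _.
  rewrite rmorph_sum exchange_big; apply: eq_bigr => y _.
  rewrite /= -gE; apply: eq_bigr => z _.
  by rewrite dotC dotBl (addcharD chiP) (addcharN chiP).
apply: eq_bigr => z _; rewrite mulr_suml mulr_sumr; apply: eq_bigr => x _.
by rewrite rmorph_sum mulr_sumr mulr_sumr.
Qed.

End OddDimension.

(** * Counting pairs of points by the value of their distance *)

Section PairCounts.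
Variables (F : finFieldType) (d : nat) (A : {set 'rV[F]_d}).

Local Notation q := (#|F|%:R : int).
Local Notation e := (eta (- 1 : F)).
Local Notation a := (#|A|%:R : int).

Definition eta_sum : int := \sum_(x in A) \sum_(y in A) eta (sqdist x y).

Definition isotropic_pairs : int :=
  \sum_(x in A) \sum_(y in A) (sqdist x y == 0)%:R.

Lemma sqdistE (x y : 'rV[F]_d) : sqdist x y = dot (x - y) (x - y).
Proof. by apply: eq_bigr => i _; rewrite !mxE expr2. Qed.

Lemma sum_diagonal : \sum_(x in A) \sum_(y in A) (x - y == 0)%:R = a.
Proof.
rewrite -[RHS]sumr_const; apply: eq_bigr => x xA.
rewrite (bigD1 x) //= subrr eqxx big1 ?addr0 // => y /andP[_ yx].
by rewrite subr_eq0 eq_sym (negPf yx).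
Qed.

Lemma card_le_isotropic_pairs : a <= isotropic_pairs.
Proof.
rewrite -sum_diagonal; apply: ler_sum => x _; apply: ler_sum => y _.
rewrite sqdistE; have [->|_] := eqVneq (x - y) 0; last exact: ler0n.
by rewrite dot0r eqxx.
Qed.

Lemma eta_sum_le : eta_sum <= a ^+ 2.
Proof.
have -> : a ^+ 2 = \sum_(x in A) \sum_(y in A) 1.
  by rewrite !sumr_const expr2 mulr_natr.
apply: ler_sum => x _; apply: ler_sum => y _.
by case: etaP.
Qed.

(** Pointwise, twice the indicator of [eta v = 1] is [1 - [v = 0] + eta v]. *)
Lemma SQ_double : (SQ A)%:R * 2 = a ^+ 2 - isotropic_pairs + eta_sum.
Proof.
have -> : (SQ A)%:R =
    \sum_(x in A) \sum_(y in A) (eta (sqdist x y) == 1)%:R :> int.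
  rewrite pair_big_dep /= /SQ -sum1_card natr_sum big_mkcond [RHS]big_mkcond.
  apply: eq_bigr => -[x y] _; rewrite !inE /=.
  by case: (x \in A); case: (y \in A); case: eqP.
have -> : a ^+ 2 = \sum_(x in A) \sum_(y in A) 1.
  by rewrite !sumr_const expr2 mulr_natr.
rewrite mulr_suml -sumrB -big_split; apply: eq_bigr => x _.
rewrite mulr_suml -sumrB -big_split; apply: eq_bigr => y _ /=.
case: etaP => [->|b b0 ->|/negPf-> _]; rewrite ?eqxx //=.
by rewrite expf_eq0 /= (negPf b0).
Qed.

Lemma pair_sum_linear (c1 c2 c3 c4 : int) :
  \sum_(x in A) \sum_(y in A) (c1 * (x - y == 0)%:R + c2 +
    c3 * eta (dot (x - y) (x - y)) + c4 * (dot (x - y) (x - y) == 0)%:R) =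
  c1 * a + c2 * a ^+ 2 + c3 * eta_sum + c4 * isotropic_pairs.
Proof.
have -> : c2 * a ^+ 2 = \sum_(x in A) \sum_(y in A) c2.
  by rewrite !sumr_const expr2 -mulrnA -natrM mulr_natr.
rewrite -sum_diagonal !mulr_sumr -!big_split; apply: eq_bigr => x _.
rewrite !mulr_sumr -!big_split; apply: eq_bigr => y _.
by rewrite !sqdistE.
Qed.

(* The hypothesis says that the weight
   [alpha + beta [x = 0] + gamma [dot x x = 0] + delta eta (dot x x)] is
   nonnegative; the conclusion sums its Fourier transform over [A - A]. *)
Lemma pair_sum_ge0 m (alpha beta gamma delta : int) :
    odd #|F| -> d = m.*2.+1 ->
    (forall x : 'rV[F]_d, 0 <= alpha + beta * (x == 0)%:R +
      gamma * (dot x x == 0)%:R + delta * eta (dot x x)) ->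
  0 <= alpha * (q ^+ d * a) + beta * a ^+ 2 +
       gamma * (q ^+ m.*2 * a + e ^+ m * q ^+ m * eta_sum) +
       delta * (e ^+ m * q ^+ m * (q * isotropic_pairs - a ^+ 2)).
Proof.
move=> oddF dE w0; have [chi chiP] := additive_character_exists F.
pose g (z : 'rV[F]_d) := alpha * (q ^+ d * (z == 0)%:R) + beta +
  gamma * (q ^+ m.*2 * (z == 0)%:R + e ^+ m * q ^+ m * eta (dot z z)) +
  delta * (e ^+ m * q ^+ m * (q * (dot z z == 0)%:R - 1)).
have gE (z : 'rV[F]_d) : \sum_x (alpha + beta * (x == 0)%:R +
      gamma * (dot x x == 0)%:R + delta * eta (dot x x))%:~R * chi (dot x z) =
    (g z)%:~R.
  transitivity (alpha%:~R * \sum_x chi (dot x z) +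
    beta%:~R * (\sum_(x : 'rV[F]_d) (x == 0)%:R * chi (dot x z)) +
    gamma%:~R * (\sum_(x : 'rV[F]_d) (dot x x == 0)%:R * chi (dot x z)) +
    delta%:~R * (\sum_(x : 'rV[F]_d) (eta (dot x x))%:~R * chi (dot x z))).
    rewrite !mulr_sumr -!big_split; apply: eq_bigr => x _ /=.
    by rewrite !rmorphD /= !intrM !rmorph_nat; ring.
  rewrite (sum_addchar_dot chiP) (fourier_isotropic chiP oddF dE).
  rewrite (fourier_eta chiP oddF dE) /g.
  have -> : \sum_(x : 'rV[F]_d) (x == 0)%:R * chi (dot x z) = 1.
    rewrite (bigD1 0) //= big1 => [|x /negPf->]; last by rewrite mul0r.
    by rewrite eqxx dotC dot0r (addchar0 chiP) addr0 mul1r.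
  by rewrite mulr1 !(intrD, intrM) !rmorphXn /= !rmorph_nat.
have := pos_def_sum chiP A w0 gE; congr (is_true (0 <= _)).
rewrite -[RHS](_ : (alpha * q ^+ d + gamma * q ^+ m.*2) * a +
  (beta - delta * (e ^+ m * q ^+ m)) * a ^+ 2 +
  gamma * (e ^+ m * q ^+ m) * eta_sum +
  delta * (e ^+ m * q ^+ m) * q * isotropic_pairs = _); last by ring.
rewrite -pair_sum_linear; apply: eq_bigr => x _; apply: eq_bigr => y _.
by rewrite /g; ring.
Qed.

End PairCounts.

(** * The three inequalities over the rationals, and the bounds *)

Lemma spectral_inequalities (F : finFieldType) (d m : nat)
    (A : {set 'rV[F]_d}) :
    odd #|F| -> d = m.*2.+1 ->
  let q : rat := #|F|%:R in
  let a : rat := #|A|%:R in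
  let eps : rat := (eta (- 1 : F) ^+ m)%:~R in
  let D : rat := (eta_sum A)%:~R in
  let N : rat := (isotropic_pairs A)%:~R in
  let K : rat := (q - 1) * q ^+ m * a in
  [/\ a ^+ 2 / q ^+ m <= q ^+ m * a + eps * D,
      eps * (D - q * N + a ^+ 2) <= K & eps * (D + q * N - a ^+ 2) <= K].
Proof.
move=> oddF dE q a eps D N K.
have Q0 : 0 < q ^+ m.
  by rewrite exprn_gt0 // ltr0n (ltn_trans _ (card_finNzRing_gt1 F)).
(* [q ^+ d] is split as [q ^+ m * (q * q ^+ m)] so that a factor [q ^+ m] can be divided out. *)
have sum_ge0 alpha beta gamma delta :
    (forall x : 'rV[F]_d, 0 <= alpha + beta * (x == 0)%:R +
      gamma * (dot x x == 0)%:R + delta * eta (dot x x)) ->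
  0 <= alpha%:~R * (q ^+ m * (q * q ^+ m) * a) + beta%:~R * a ^+ 2 +
    gamma%:~R * q ^+ m * (q ^+ m * a + eps * D) +
    delta%:~R * q ^+ m * (eps * (q * N - a ^+ 2)).
  move=> /(pair_sum_ge0 A oddF dE); rewrite -(ler0z rat).
  congr (is_true (0 <= _)); rewrite !(intrD, intrM, rmorphN) /=.
  rewrite -exprS -exprD addnS addnn -dE !rmorphXn /= !rmorph_nat.
  by rewrite -addnn exprD /eps rmorphXn /= -/D -/N -/a -/q; ring.
split.
- rewrite ler_pdivrMr // -subr_ge0.
  (* Weight: the indicator of the nonzero isotropic vectors. *)
  have /sum_ge0 : forall x : 'rV[F]_d, 0 <= 0 + -1 * (x == 0)%:R +
      1 * (dot x x == 0)%:R + 0 * eta (dot x x) :> int.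
    move=> x; rewrite mul0r; have [->|_] := eqVneq x 0.
      by rewrite dot0r eqxx.
    by case: (dot x x == 0).
  by congr (is_true (0 <= _)); ring.
(* Weight: twice the indicator of [eta (dot x x) = 1]. *)
- have /sum_ge0 : forall x : 'rV[F]_d, 0 <= 1 + 0 * (x == 0)%:R +
      -1 * (dot x x == 0)%:R + 1 * eta (dot x x) :> int.
    move=> x; rewrite mul0r; case: etaP => [->|b b0 ->|/negPf->] //.
      by rewrite eqxx.
    by rewrite expf_eq0 (negPf b0).
  rewrite -[_ <= K]subr_ge0 -(pmulr_rge0 _ Q0).
  by congr (is_true (0 <= _)); rewrite /K; ring.
(* Weight: twice the indicator of [eta (dot x x) = -1]. *)
- have /sum_ge0 : forall x : 'rV[F]_d, 0 <= 1 + 0 * (x == 0)%:R +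
      -1 * (dot x x == 0)%:R + -1 * eta (dot x x) :> int.
    move=> x; rewrite mul0r; case: etaP => [->|b b0 ->|/negPf->] //.
      by rewrite eqxx.
    by rewrite expf_eq0 (negPf b0).
  rewrite -[_ <= K]subr_ge0 -(pmulr_rge0 _ Q0).
  by congr (is_true (0 <= _)); rewrite /K; ring.
Qed.

(* q = #|F| odd; d odd in both parts, so q^((d-1)/2) = q ^+ (d.-1)./2 exactly. *)
Theorem theorem1p4 (F : finFieldType) (d : nat) (A : {set 'rV[F]_d}) :
  odd #|F| -> (0 < d)%N ->
  let q : rat := (#|F|)%:R in
  let a : rat := (#|A|)%:R in
  let s : rat := (SQ A)%:R in
  let m := (d.-1)./2 in
  ((d %% 4 = 3)%N -> (#|F| %% 4 = 3)%N ->
     (q ^+ m.+1 + q) / (1 + (q ^+ m)^-1) <= a ->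
     s <= a ^+ 2 / 2 + q ^+ m * a - a ^+ 2 / (2 * q)
          - a ^+ 2 / (2 * q ^+ m) - a ^+ 2 / (2 * q ^+ m.+1))
  /\
  ((d %% 4 = 3)%N -> (#|F| %% 4 = 3)%N ->
     a <= (q ^+ m.+1 + q) / (1 + (q ^+ m)^-1) ->
     s <= a ^+ 2 / 2 + q ^+ m * a / 2 - a ^+ 2 / (2 * q ^+ m) - a / 2)
  /\
  ((d %% 4 = 1)%N \/ ((d %% 4 = 3)%N /\ (#|F| %% 4 = 1)%N) ->
     s <= a ^+ 2 / 2 - q ^+ m * a / 2 - a / 2
          + Num.min (q ^+ m.+1 * a / 2)
              (Num.min (q ^+ m * a / 2 + a ^+ 2 / 2)
                       (a / 2 + q ^+ m.+1 * a / 2 - a ^+ 2 / (2 * q)))).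
Proof.
move=> oddF d0 q a s m.
have q1 : 1 < q by rewrite ltr1n card_finNzRing_gt1.
have Q0 : 0 < q ^+ m by rewrite exprn_gt0 //; lra.
have dE : (d %% 4 = 3)%N \/ (d %% 4 = 1)%N -> d = m.*2.+1 by rewrite /m; lia.
pose D : rat := (eta_sum A)%:~R; pose N : rat := (isotropic_pairs A)%:~R.
have aN : a <= N.
  by have := card_le_isotropic_pairs A; rewrite -(ler_int rat) rmorph_nat.
have Da : D <= a ^+ 2.
  by have := eta_sum_le A; rewrite -(ler_int rat) rmorphXn /= rmorph_nat.
have sE : s * 2 = a ^+ 2 - N + D.
  have /(congr1 (intr : int -> rat)) := SQ_double A.
  by rewrite intrM [in RHS]intrD [in RHS]intrB rmorphXn /= !rmorph_nat.
(* Naming the quotients lets [lra] treat them as atoms, tied together by [uq] and [wq]. *)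
pose u := a ^+ 2 / q; pose v := a ^+ 2 / q ^+ m.
have n0 : q != 0 by apply: lt0r_neq0; lra.
have uq : q * u = a ^+ 2 by rewrite mulrC divfK.
have -> : a ^+ 2 / (2 * q) = u / 2 by rewrite /u !invfM; ring.
have -> : a ^+ 2 / (2 * q ^+ m) = v / 2 by rewrite /v !invfM; ring.
have -> : a ^+ 2 / (2 * q ^+ m.+1) = v / q / 2.
  by rewrite [q ^+ m.+1]exprS /v !invfM; ring.
(* The residue of [d] modulo 4 decides the parity of [m]: odd here, even in [eps41]. *)
have eps43 : (d %% 4 = 3)%N -> (eta (- 1 : F)) ^+ m = eta (- 1 : F).
  move=> d3; have mE : m = (d %/ 4).*2.+1.
    by rewrite /m; lia.
  by rewrite mE exprS -mul2n exprM sqr_eta_opp1 expr1n mulr1.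
have eps41 : (d %% 4 = 1)%N -> (eta (- 1 : F)) ^+ m = 1.
  move=> d1; have mE : m = (d %/ 4).*2.
    by rewrite /m; lia.
  by rewrite mE -mul2n exprM sqr_eta_opp1 expr1n.
have wq : q * (v / q) = v by rewrite mulrC divfK.
split=> [d3 F3 _|].
  have [I1 _ I3] := spectral_inequalities A oddF (dE (or_introl d3)).
  rewrite eps43 // eta_opp1_mod43 // mulN1r in I1 I3.
  rewrite -/v -/q -/a -/D -/N in I1 I3.
  (* Doubled and multiplied by [q], the claim is [q + 1] times [I1] plus [I3]. *)
  have I1q : 0 <= (q + 1) * (q ^+ m * a - D - v) by apply: mulr_ge0; lra.
  have : 0 <= q * (2 * (q ^+ m * a) - u - v - v / q - D + N) by lra.
  by rewrite pmulr_rge0; lra.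
split=> [d3 F3 _|dF].
  have [I1 _ _] := spectral_inequalities A oddF (dE (or_introl d3)).
  rewrite eps43 // eta_opp1_mod43 // mulN1r in I1.
  (* [I1] gives [D <= q ^+ m * a - v]; combine it with [aN]. *)
  by rewrite -/v -/q -/a -/D in I1; lra.
have d_odd : (d %% 4 = 3)%N \/ (d %% 4 = 1)%N by case: dF => [|[]]; [right|left].
have eps1 : eta (- 1 : F) ^+ m = 1.
  by case: dF => [/eps41//|[d3 F1]]; rewrite eps43 // eta_opp1_mod41.
have [_ I2 I3] := spectral_inequalities A oddF (dE d_odd).
rewrite eps1 !mul1r -/q -/a -/D -/N in I2 I3.
(* The first bound averages [I2] and [I3], the second uses [Da]; both then use [aN]. *)
rewrite -lerBlDl !le_min [q ^+ m.+1]exprS; apply/and3P; split.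
- by lra.
- by lra.
(* In the third bound, [q + 1] times [I2] plus [q - 1] times [I3] is [2 * q] times the desired
   inequality on [D] and [N]. *)
have I2q : 0 <= (q + 1) * ((q - 1) * q ^+ m * a - D + q * N - a ^+ 2).
  by apply: mulr_ge0; lra.
have I3q : 0 <= (q - 1) * ((q - 1) * q ^+ m * a - D - q * N + a ^+ 2).
  by apply: mulr_ge0; lra.
have : 0 <= q * ((q - 1) * q ^+ m * a - D + N - u) by lra.
by rewrite pmulr_rge0; lra.
Qed.
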